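(* Let $(X,M,* )$ be a fuzzy metric space. Then $(X,M,* )$ is Lebesgue if and only if every fuzzy pseudo-Cauchy sequence in $(X,M,* )$ having distinct terms has a cluster point in $(X,\tau_M)$.
   Context: A continuous $t$-norm is a binary operation $*$ on $[0,1]$ that is associative, commutative, continuous on $[0,1]\times[0,1]$, satisfies $a*1=a$ for all $a\in[0,1]$, and satisfies $a*c\le b*d$ whenever $a\le b$ and $c\le d$. A fuzzy metric space (George–Veeramani) is a triple $(X,M,* )$ where $X$ is a non-empty set, $*$ is a continuous $t$-norm and $M:X\times X\times(0,\infty)\to[0,1]$ satisfies, for all $x,y,z\in X$ and $s,t>0$: (a) $M(x,y,t)>0$; (b) $M(x,y,t)=1$ if and only if $x=y$; (c) $M(x,y,t)=M(y,x,t)$; (d) $M(x,y,t)*M(y,z,s)\le M(x,z,t+s)$; (e) $M(x,y,\cdot):(0,\infty)\to[0,1]$ is continuous. For $x\in X$, $r\in(0,1)$, $t>0$ put $B_M(x,r,t)=\{y\in X: M(x,y,t)>1-r\}$; these sets form a base of a topology $\tau_M$ on $X$. A fuzzy metric space $(X,M,* )$ is Lebesgue (has the Lebesgue property) if for every open cover $\mathcal G$ of $(X,\tau_M)$ there exist $r\in(0,1)$ and $t>0$ such that $\{B_M(x,r,t):x\in X\}$ refines $\mathcal G$, i.e. each $B_M(x,r,t)$ is contained in some member of $\mathcal G$. A sequence $(x_n)$ in $(X,M,* )$ is fuzzy pseudo-Cauchy if for all $\epsilon\in(0,1)$, $t>0$ and $k\in\mathbb N$ there exist $j,n\in\mathbb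 N$ with $j,n>k$, $j\ne n$, such that $M(x_j,x_n,t)>1-\epsilon$. *)

(* Defs.v *)
From HB Require Import structures.
From mathcomp Require Import all_boot all_order all_algebra.
From mathcomp Require Import lra.
From mathcomp Require Import all_classical all_reals all_analysis.

Set Implicit Arguments.
Unset Strict Implicit.
Unset Printing Implicit Defensive.

Import Order.TTheory GRing.Theory Num.Theory.
Import numFieldNormedType.Exports.

Local Open Scope classical_set_scope.
Local Open Scope ring_scope.

(* A binary operation on [0, 1] is represented by a total T : R -> R -> R that
   preserves [0, 1]; its values outside [0, 1] x [0, 1] are unconstrained and
   never used. *)
Record continuous_tnorm (R : realType) (T : R -> R -> R) : Prop := {
  tnorm_closed : forall a b, 0 <= a <= 1 -> 0 <= b <= 1 -> 0 <= T a b <= 1 ;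
  tnorm_assoc : forall a b c, 0 <= a <= 1 -> 0 <= b <= 1 -> 0 <= c <= 1 ->
    T a (T b c) = T (T a b) c ;
  tnorm_comm : forall a b, 0 <= a <= 1 -> 0 <= b <= 1 -> T a b = T b a ;
  tnorm_continuous :
    {within `[0, 1] `*` `[0, 1], continuous (fun p : R * R => T p.1 p.2)} ;
  tnorm_1r : forall a, 0 <= a <= 1 -> T a 1 = a ;
  tnorm_le : forall a b c d, 0 <= a <= 1 -> 0 <= b <= 1 -> 0 <= c <= 1 ->
    0 <= d <= 1 -> a <= b -> c <= d -> T a c <= T b d
}.

(* Fuzzy metric spaces in the sense of George and Veeramani.  The parameter t
   of fm x y t ranges over all of R, but only its values at t > 0 are
   constrained or used. *)
Record fuzzyMetricSpace (R : realType) := FuzzyMetricSpace {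
  fm_carrier :> Type ;
  fm_tnorm : R -> R -> R ;
  fm : fm_carrier -> fm_carrier -> R -> R ;
  fm_nonempty : [set: fm_carrier] !=set0 ;
  fm_tnormP : continuous_tnorm fm_tnorm ;
  fm_itv : forall x y t, 0 < t -> 0 <= fm x y t <= 1 ;
  fm_gt0 : forall x y t, 0 < t -> 0 < fm x y t ;
  fm_eq1 : forall x y t, 0 < t -> fm x y t = 1 <-> x = y ;
  fm_sym : forall x y t, 0 < t -> fm x y t = fm y x t ;
  fm_triangle : forall x y z s t, 0 < s -> 0 < t ->
    fm_tnorm (fm x y t) (fm y z s) <= fm x z (t + s) ;
  fm_continuous : forall x y, {within `]0, +oo[, continuous (fm x y)}
}.

Section Topology.
Context {R : realType} (X : fuzzyMetricSpace R).
Implicit Types (x y z : X) (r t : R).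

Definition fm_ball x r t : set X := [set y | fm x y t > 1 - r].

Definition fm_balls : set (set X) :=
  [set B | exists x r t, [/\ 0 < r < 1, 0 < t & B = fm_ball x r t]].

Lemma fm_refl x t : 0 < t -> fm x x t = 1.
Proof. by move=> t0; apply/fm_eq1. Qed.

Lemma fm_ball_center x r t : 0 < r -> 0 < t -> fm_ball x r t x.
Proof. by move=> r0 t0; rewrite /fm_ball /= fm_refl// ltrBlDr ltrDl. Qed.

Lemma fm_nondecreasing x y s t : 0 < s -> s <= t -> fm x y s <= fm x y t.
Proof.
move=> s0; rewrite le_eqVlt => /predU1P[->//|st].
have ts0 : 0 < t - s by rewrite subr_gt0.
have := fm_triangle x y y ts0 s0.
by rewrite fm_refl// (tnorm_1r (fm_tnormP X)) ?fm_itv// addrC subrK.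
Qed.

Lemma fm_left_witness x y t a : 0 < t -> a < fm x y t ->
  exists s, 0 < s < t /\ a < fm x y s.
Proof.
move=> t0 axy.
have tin : `]0, +oo[%classic t by rewrite /= in_itv/= t0.
have /subspace_continuousP/(_ t tin) := @fm_continuous R X x y.
move=> /cvgrPdist_lt /(_ (fm x y t - a)).
rewrite subr_gt0 => /(_ axy); rewrite /within/= => /nbhs_ballP[e /= e0 He].
pose s := Num.max (t / 2) (t - e / 2).
have s0 : 0 < s by rewrite lt_max divr_gt0.
have st : s < t by rewrite gt_max; apply/andP; split; lra.
have tes : t - e / 2 <= s by rewrite le_max lexx orbT.
exists s; split; first by rewrite s0 st.
have : `|fm x y t - fm x y s| < fm x y t - a.
  apply: He; last by rewrite in_itv/= s0.
  by rewrite /ball/= gtr0_norm ?subr_gt0//; lra.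
by move=> /(le_lt_trans (ler_norm _)); lra.
Qed.

Lemma tnorm_left_witness (T : R -> R -> R) (a b : R) :
  continuous_tnorm T -> 0 <= b <= 1 -> a < b ->
  exists s, 0 < s < 1 /\ a < T b (1 - s).
Proof.
move=> hT b01 ab.
have bin : (`[0, 1] `*` `[0, 1])%classic (b, 1 : R).
  by split; rewrite /= in_itv/= ?b01// ler01 lexx.
have /subspace_continuousP/(_ (b, 1) bin) := tnorm_continuous hT.
move=> /cvgrPdist_lt /(_ (b - a)).
rewrite subr_gt0 => /(_ ab); rewrite /within/= => /nbhs_ballP[e /= e0 He].
pose s := Num.min (1 / 2) (e / 2).
have s0 : 0 < s by rewrite lt_min; apply/andP; split; lra.
have s1 : s <= 1 / 2 by rewrite ge_min lexx.
have se : s <= e / 2 by rewrite ge_min lexx orbT.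
exists s; split; first by apply/andP; split; lra.
have : `|T b 1 - T b (1 - s)| < b - a.
  apply: (He (b, 1 - s)).
    split; first exact: ballxx.
    rewrite /ball/= opprB addrCA subrr addr0 gtr0_norm//; lra.
  by split; rewrite /= in_itv/= ?b01//; apply/andP; split; lra.
by rewrite (tnorm_1r hT)// => /(le_lt_trans (ler_norm _)); lra.
Qed.

Lemma fm_ball_sub x r t y : 0 < r < 1 -> 0 < t -> fm_ball x r t y ->
  exists r' t', [/\ 0 < r' < 1, 0 < t' & fm_ball y r' t' `<=` fm_ball x r t].
Proof.
move=> r01 t0 /(fm_left_witness t0)[s [/andP[s0 st] axy]].
have xy01 := fm_itv x y s0.
have [r' [r'01 ar']] := tnorm_left_witness (fm_tnormP X) xy01 axy.
have ts0 : 0 < t - s by rewrite subr_gt0.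
exists r', (t - s); split=> // z; rewrite /fm_ball/= => yz.
apply: (lt_le_trans ar').
have := fm_triangle x y z ts0 s0; rewrite (addrC s) subrK; apply: le_trans.
have /andP[r'0 r'1] := r'01.
apply: (tnorm_le (fm_tnormP X)) => //; [|exact: fm_itv|exact: ltW].
by apply/andP; split; lra.
Qed.

Lemma fm_balls_cover : \bigcup_(B in fm_balls) B = setT.
Proof.
rewrite -subTset => x _; exists (fm_ball x (1 / 2) 1).
  by exists x, (1 / 2), 1; split=> //; apply/andP; split; lra.
by apply: fm_ball_center => //; lra.
Qed.

Lemma fm_balls_join (B C : set X) x : fm_balls B -> fm_balls C -> B x -> C x ->
  exists D, [/\ fm_balls D, D x & D `<=` B `&` C].
Proof.
move=> [y [r [t [r01 t0 ->]]]] [z [r' [t' [r'01 t'0 ->]]]] Bx Cx.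
have [u [s [/andP[u0 u1] s0 us]]] := fm_ball_sub r01 t0 Bx.
have [u' [s' [/andP[u'0 u'1] s'0 us']]] := fm_ball_sub r'01 t'0 Cx.
pose v := Num.min u u'; pose w := Num.min s s'.
have v0 : 0 < v by rewrite lt_min u0.
have w0 : 0 < w by rewrite lt_min s0.
exists (fm_ball x v w); split; last 2 first.
- exact: fm_ball_center.
- move=> p xp; split; [apply: us|apply: us']; move: xp; rewrite /fm_ball/=.
  + have vu : v <= u by rewrite ge_min lexx.
    have ws : w <= s by rewrite ge_min lexx.
    by have := fm_nondecreasing x p w0 ws; lra.
  + have vu : v <= u' by rewrite ge_min lexx orbT.
    have ws : w <= s' by rewrite ge_min lexx orbT.
    by have := fm_nondecreasing x p w0 ws; lra.
by exists x, v, w; split=> //; rewrite v0 gt_min u1.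
Qed.

HB.instance Definition _ := gen_eqMixin (fm_carrier X).
HB.instance Definition _ := gen_choiceMixin (fm_carrier X).
(* The open sets are exactly the unions of subfamilies of fm_balls. *)
HB.instance Definition _ := isBaseTopological.Build (fm_carrier X)
  fm_balls_cover fm_balls_join.

End Topology.

Definition refines {T : Type} (U V : set (set T)) :=
  forall A, U A -> exists2 B, V B & A `<=` B.

Definition fm_lebesgue {R : realType} (X : fuzzyMetricSpace R) :=
  forall G : set (set X), (forall U, G U -> open U) ->
    \bigcup_(U in G) U = setT ->
    exists r t : R, [/\ 0 < r < 1, 0 < t &
      refines [set fm_ball x r t | x in [set: X]] G].

Definition fuzzy_pseudo_cauchy {R : realType} (X : fuzzyMetricSpace R)
    (u : nat -> X) :=
  forall (eps t : R) (k : nat), 0 < eps < 1 -> 0 < t ->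
    exists j n : nat, [/\ (k < j)%N, (k < n)%N, j != n &
      fm (u j) (u n) t > 1 - eps].

(* Main.v *)
Require Import Defs.
From HB Require Import structures.
From mathcomp Require Import all_boot all_order all_algebra.
From mathcomp Require Import lra zify.
From mathcomp Require Import all_classical all_reals all_analysis.

Set Implicit Arguments.
Unset Strict Implicit.
Unset Printing Implicit Defensive.

Import Order.TTheory GRing.Theory Num.Theory.

Local Open Scope classical_set_scope.
Local Open Scope ring_scope.

(** If [u] is pseudo-Cauchy with distinct terms and has no cluster point, then,
    balls separating points, the open sets containing at most one term of [u]
    form a cover.  A Lebesgue pair [(r, t)] for this cover contradicts the
    existence of [j != n] with [M(u_j, u_n, t) > 1 - r].

    Conversely, let [G] be an open cover without a Lebesgue pair.  For each [n]
    some ball [B(x_n, 1/(n+2), 1/(n+2))] lies in no member of [G]; it contains a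
    point [y_n] outside a member of [G] around [x_n], so [y_n <> x_n].  Near any
    point [p] there are only finitely many [x_n] and [y_n]: otherwise, by
    continuity of the t-norm at (1, 1), one of these small balls would fit in a
    member of [G] around [p].  Hence [x] and [y] can be thinned out to pairs
    that are all disjoint, and the interleaving [x_0, y_0, x_1, y_1, ...] is a
    pseudo-Cauchy sequence with distinct terms and no cluster point. *)

Lemma fm_ball_open (R : realType) (X : fuzzyMetricSpace R) (x : X) (r t : R) :
  0 < r < 1 -> 0 < t -> open (fm_ball x r t : set X).
Proof.
move=> r01 t0; exists [set (fm_ball x r t : set X)].
  by move=> _ ->; exists x, r, t.
by rewrite bigcup_set1.
Qed.

Lemma nbhs_fm_ball (R : realType) (X : fuzzyMetricSpace R) (x : X) (r t : R) :
  0 < r < 1 -> 0 < t -> nbhs x (fm_ball x r t : set X).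
Proof.
move=> r01 t0; apply: open_nbhs_nbhs; split; first exact: fm_ball_open.
by apply: fm_ball_center => //; case/andP: r01.
Qed.

Lemma open_fm_ballP (R : realType) (X : fuzzyMetricSpace R) (U : set X)
    (x : X) :
  open U -> U x ->
  exists r t, [/\ 0 < r < 1, 0 < t & fm_ball x r t `<=` U].
Proof.
move=> [D' sD <-] [B D'B Bx].
have [y [r [t [r01 t0 BE]]]] := sD _ D'B.
have [r' [t' [r'01 t'0 sub]]] : exists r' t',
    [/\ 0 < r' < 1, 0 < t' & fm_ball x r' t' `<=` fm_ball y r t].
  by apply: fm_ball_sub => //; rewrite -BE.
by exists r', t'; split=> // z /sub yz; exists B => //; rewrite BE.
Qed.

Lemma fm_ball_le (R : realType) (X : fuzzyMetricSpace R) (x : X)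
    (r r' t t' : R) :
  0 < t -> r <= r' -> t <= t' -> fm_ball x r t `<=` fm_ball x r' t'.
Proof.
move=> t0 rr' tt' y; rewrite /fm_ball/= => xy.
by have := fm_nondecreasing x y t0 tt'; lra.
Qed.

Lemma fm_ball_sym (R : realType) (X : fuzzyMetricSpace R) (x y : X) (r t : R) :
  0 < t -> fm_ball x r t y -> fm_ball y r t x.
Proof. by move=> t0; rewrite /fm_ball/= fm_sym. Qed.

(** Plays the role of halving a radius. Left continuity of the t-norm at [(1 - r / 2, 1)] gives [s]
    with [1 - r < (1 - r / 2) * (1 - s)]; by monotonicity, two steps of radius [min (r / 2) s] and
    parameter [t / 2] stay in the ball of radius [r] and parameter [t]. *)
Lemma open_fm_half (R : realType) (X : fuzzyMetricSpace R) (U : set X) (p : X) :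
  open U -> U p -> exists s t : R, [/\ 0 < s < 1, 0 < t &
    forall q w, fm_ball p s t q -> fm_ball q s t w -> U w].
Proof.
move=> oU Up; have [r [t [/andP[r0 r1] t0 sub]]] := open_fm_ballP oU Up.
have hr : 0 <= 1 - r / 2 <= 1 by apply/andP; split; lra.
have rr : 1 - r < 1 - r / 2 by lra.
have [s [/andP[s0 s1] rs]] := tnorm_left_witness (fm_tnormP X) hr rr.
pose v := Num.min (r / 2) s.
have v0 : 0 < v by rewrite lt_min s0 divr_gt0.
have v1 : v < 1 by rewrite gt_min s1 orbT.
have vr : v <= r / 2 by rewrite ge_min lexx.
have vs : v <= s by rewrite ge_min lexx orbT.
have t20 : 0 < t / 2 by rewrite divr_gt0.
exists v, (t / 2); split=> //; first by rewrite v0.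
move=> q w pq qw; apply: sub; rewrite /fm_ball/= in pq qw *.
apply: (lt_le_trans rs); rewrite [t]splitr.
apply: le_trans (fm_triangle p q w t20 t20).
apply: (tnorm_le (fm_tnormP X)) ; try exact: fm_itv; lra.
Qed.

Lemma fm_separated (R : realType) (X : fuzzyMetricSpace R) (x y : X) :
  x <> y -> nbhs x [set z : X | z <> y].
Proof.
move=> xy; have t0 : (0 : R) < 1 by [].
have m1 : fm x y 1 < 1.
  have /andP[_] := fm_itv x y t0; rewrite le_eqVlt => /predU1P[|//].
  by move/(fm_eq1 x y t0).
have m0 := fm_gt0 x y t0.
(* The radius [1 - fm x y 1] is the largest whose ball at parameter 1 excludes [y]. *)
apply: (filterS _ (nbhs_fm_ball x (r := 1 - fm x y 1) (t := 1) _ _)) => //.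
  by move=> z; rewrite /fm_ball/= => xz zy; move: xz; rewrite zy; lra.
by apply/andP; split; lra.
Qed.

(** Points are separated and only finitely many terms are involved. The conclusion [y = x] allows
    for [x] being itself one of these terms. *)
Lemma nbhs_avoid_initial (R : realType) (X : fuzzyMetricSpace R) (u : nat -> X)
    (x : X) (N : nat) :
  nbhs x [set y : X | forall n, (n < N)%N -> y = u n -> y = x].
Proof.
elim: N => [|N IH]; first exact: filterE.
have hN : nbhs x [set y : X | y = u N -> y = x].
  have [->|xu] := pselect (x = u N); first by apply: filterE => y.
  by apply: filterS (fm_separated xu) => y yu /yu.
apply: filterS (filterI IH hN) => y [h1 h2] n.
by rewrite ltnS leq_eqVlt => /predU1P[->|/h1].
Qed.

Lemma not_cluster_seq (T : topologicalType) (u : nat -> T) (p : T) :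
  ~ cluster (u @ \oo) p ->
  exists2 W, nbhs p W & exists N, forall n, (N <= n)%N -> ~ W (u n).
Proof.
move=> ncl; apply: contrapT => H; apply: ncl => A B [N _ uA] nB.
apply: contrapT => AB; apply: H; exists B => //; exists N => n Nn Bu.
by apply: AB; exists (u n); split => //; apply: uA.
Qed.

Lemma lebesgue_cluster (R : realType) (X : fuzzyMetricSpace R) (u : nat -> X) :
  fm_lebesgue X -> fuzzy_pseudo_cauchy u -> injective u ->
  exists p : X, cluster (u @ \oo) p.
Proof.
move=> leb pc inju; apply: contrapT => ncl.
pose G := [set U : set X | open U /\ forall i j, U (u i) -> U (u j) -> i = j].
have [r [t [/andP[r0 r1] t0 ref]]] :
    exists r t : R, [/\ 0 < r < 1, 0 < t &
      refines [set fm_ball x r t | x in [set: X]] G].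
  apply: leb; first by move=> U [].
  rewrite -subTset => x _.
  have [W nW [N WN]] : exists2 W, nbhs x W &
      exists N, forall n, (N <= n)%N -> ~ W (u n).
    by apply: not_cluster_seq => cx; apply: ncl; exists x.
  have : nbhs x (W `&` [set y : X | forall n, (n < N)%N -> y = u n -> y = x]).
    by apply: filterI => //; exact: nbhs_avoid_initial.
  rewrite nbhsE => -[U [oU Ux] sub]; exists U => //; split=> // i j.
  (* [W] rules out the indices from [N] on, and below [N] the only value left is [x]. *)
  have ux k : U (u k) -> u k = x.
    move=> /sub[Wk /(_ k)]; apply => //.
    by rewrite ltnNge; apply/negP => /WN.
  by move=> /ux ix /ux jx; apply: inju; rewrite ix.
have [|j [n [_ _ jn jnt]]] := pc r t 0 _ t0; first by rewrite r0.
have [U [_ Uinj] sub] := ref _ (ex_intro2 _ _ (u j) I erefl).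
move/eqP: jn; apply; apply: Uinj; apply: sub => //.
exact: fm_ball_center.
Qed.

Lemma not_lebesgue_pairs (R : realType) (X : fuzzyMetricSpace R) :
  ~ fm_lebesgue X -> exists x y : nat -> X,
    [/\ forall n, x n <> y n,
        forall n, fm_ball (x n) n.+2%:R^-1 n.+2%:R^-1 (y n) &
        forall p : X, exists2 W, nbhs p W & exists N, forall n, (N <= n)%N ->
          ~ W (x n) /\ ~ W (y n)].
Proof.
move=> nleb.
have [G [oG cG nG]] : exists G : set (set X),
    [/\ forall U, G U -> open U, \bigcup_(U in G) U = setT &
     forall r t : R, 0 < r < 1 -> 0 < t ->
       exists x, forall U, G U -> ~ (fm_ball x r t `<=` U)].
  apply: contrapT => H; apply: nleb => G oG cG; apply: contrapT => nG.
  apply: H; exists G; split=> // r t r01 t0; apply: contrapT => H.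
  apply: nG; exists r, t; split=> // _ [x _ <-].
  apply: contrapT => H'; apply: H; exists x => U GU xU.
  by apply: H'; exists U.
(* The shift by 2 keeps [h 0] below 1, as a radius must be. *)
pose h n : R := n.+2%:R^-1.
have h0 n : 0 < h n by rewrite invr_gt0.
have h1 n : h n < 1 by rewrite invf_lt1 // ltr1n.
have /choice[x xG] : forall n, exists x, forall U, G U ->
    ~ (fm_ball x (h n) (h n) `<=` U).
  by move=> n; apply: nG; rewrite ?h0 ?h1.
have coverG z : exists2 U, G U & U z.
  by have : [set: X] z by []; rewrite -cG => -[U]; exists U.
have /choice[y xy] : forall n, exists y, x n <> y /\
    fm_ball (x n) (h n) (h n) y.
  move=> n; have [U GU Ux] := coverG (x n).
  have /existsNP[y /not_implyP[xy nUy]] := xG n U GU.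
  by exists y; split => // xyE; apply: nUy; rewrite -xyE.
exists x, y; split=> [n|n|p]; [by case: (xy n)|by case: (xy n)|].
have [U GU Up] := coverG p.
have [s [t [s01 t0 sub]]] := open_fm_half (oG _ GU) Up.
have [s0 _] := andP s01.
(* A second halving handles [y n]: if it is near [p], then [x n], being close to [y n], falls in
   [fm_ball p s t], which the first halving excludes. *)
have [s' [t' [s'01 t'0 sub']]] := open_fm_half (fm_ball_open p s01 t0)
  (fm_ball_center p s0 t0).
have [s'0 _] := andP s'01.
pose e := Num.min (Num.min s t) (Num.min s' t').
have e0 : 0 < e by rewrite !lt_min s0 t0 s'0.
have [N hN] : exists N, forall n, (N <= n)%N -> h n < e.
  have [N _ HN] := near_infty_natSinv_lt (PosNum e0).
  by exists N => n Nn; apply: (HN n.+1) => /=; apply: leqW.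
exists (fm_ball p s t `&` fm_ball p s' t').
  by apply: filterI; apply: nbhs_fm_ball.
exists N => n Nn; have := hN n Nn.
rewrite !lt_min => /andP[/andP[/ltW hs /ltW ht] /andP[/ltW hs' /ltW ht']].
have far : ~ fm_ball p s t (x n).
  move=> px; apply: (xG n U GU) => w xw.
  by apply: sub px _; apply: fm_ball_le xw.
split=> -[// _ py]; apply: far; apply: sub' py _.
by apply: fm_ball_sym => //; have [_] := xy n; apply: fm_ball_le.
Qed.

Theorem theorem3p1 (R : realType) (X : fuzzyMetricSpace R) :
  fm_lebesgue X <->
  forall u : nat -> X, fuzzy_pseudo_cauchy u -> injective u ->
    exists p : X, cluster (u @ \oo) p.
Proof.
split=> [leb u|clu]; first exact: lebesgue_cluster.
apply: contrapT => /not_lebesgue_pairs[x [y [xNy xy loc]]].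
(* From index [g i] on, both sequences have left the neighbourhoods of [x i] and [y i] on which they
   are eventually absent. *)
have /choice[g gP] : forall i, exists m, (i < m)%N /\ forall n, (m <= n)%N ->
    [/\ x n <> x i, x n <> y i, y n <> x i & y n <> y i].
  move=> i; have [V nV [N VN]] := loc (x i); have [W nW [M WM]] := loc (y i).
  exists (maxn i.+1 (maxn N M)); split; first by lia.
  move=> n hn; have [|Vx Vy] := VN n; first by lia.
  have [|Wx Wy] := WM n; first by lia.
  have Vi := nbhs_singleton nV; have Wi := nbhs_singleton nW.
  by split=> E; [apply: Vx|apply: Wx|apply: Vy|apply: Wy]; rewrite E.
pose f k := iter k g 0%N.
(* Makes each selected pair disjoint from all later ones, not only from the next. *)
have f_ge k l : (k < l)%N -> (g (f k) <= f l)%N.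
  elim: l => // l IH; rewrite ltnS leq_eqVlt => /predU1P[->//|/IH kl].
  by apply: (leq_trans kl); apply: ltnW; case: (gP (f l)).
have f_id k : (k <= f k)%N.
  by elim: k => // k IH; apply: (leq_ltn_trans IH); case: (gP (f k)).
pose z k := if odd k then y (f k./2) else x (f k./2).
have z_neq k l : (k./2 < l./2)%N -> z l <> z k.
  move=> /f_ge kl; have [_ /(_ _ kl)[]] := gP (f k./2).
  by rewrite /z; case: (odd l); case: (odd k).
have z_inj : injective z.
  move=> k l zkl; case: (ltngtP k./2 l./2) => [/z_neq|/z_neq|hkl].
  - by rewrite zkl.
  - by rewrite zkl.
  (* Within one pair only the parity can differ, and [xNy] excludes that. *)
  - rewrite -(odd_double_half k) -(odd_double_half l) hkl; congr (_ + _)%N.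
    have := xNy (f l./2); move: zkl; rewrite /z hkl.
    by case: (odd k); case: (odd l) => // ->.
have [|p clp] := clu z _ z_inj.
  move=> e t k /andP[e0 e1] t0.
  pose d := Num.min e t.
  have d0 : 0 < d by rewrite lt_min e0.
  have [N _ HN] := near_infty_natSinv_lt (PosNum d0).
  (* Large enough for [m.*2] to exceed [k] and for the radius at [f m >= m] to drop below [d]. *)
  pose m := (N + k).+1.
  exists m.*2, m.*2.+1; split; [by rewrite /m; lia|by rewrite /m; lia|lia|].
  have -> : z m.*2 = x (f m) by rewrite /z odd_double doubleK.
  have -> : z m.*2.+1 = y (f m) by rewrite /z /= odd_double uphalf_double.
  have : ((f m).+2%:R^-1 : R) < d.
    apply: (HN (f m).+1); apply: leqW; apply: leq_trans (f_id m).
    by rewrite /m; lia.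
  rewrite lt_min => /andP[/ltW de /ltW dt].
  by have := xy (f m); apply: fm_ball_le => //; rewrite invr_gt0.
have [W nW [N WN]] := loc p.
have zW : (z @ \oo) (~` W).
  exists N.*2 => // k /= Nk; rewrite /z.
  have Nf : (N <= f k./2)%N by apply: leq_trans (f_id _); lia.
  by have [Wx Wy] := WN _ Nf; case: (odd k).
by have [q []] := clp _ _ zW nW.
Qed.
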